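(* Let $\mathbf{C}$ be a Heyting category that admits a generic monomorphism and let $\Box:\mathbf{C}\to\mathbf{C}$ be a Cartesian comonad. Then the category of coalgebras $\mathbf{C}^{\Box}$ is again a Heyting category that admits a generic monomorphism.
   Context: A Cartesian comonad is a comonad whose underlying functor preserves finite limits. A generic monomorphism in a category is a monomorphism $t$ such that every monomorphism of the category is a pullback of $t$. A Heyting category is a coherent category in which every pullback functor $f^*:\mathrm{Sub}(B)\to\mathrm{Sub}(A)$ on subobjects has a right adjoint $\forall_f$. *)

(* Defs.v *)
From Stdlib Require Import List FinFun ProofIrrelevance.

Set Implicit Arguments.
Unset Strict Implicit.
Unset Printing Implicit Defensive.

Declare Scope cat_scope.
Delimit Scope cat_scope with cat.
Local Open Scope cat_scope.

(** * Categories, functors, natural transformations *)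

Record Category := {
  Ob :> Type;
  Hom : Ob -> Ob -> Type;
  idm : forall A, Hom A A;
  comp : forall A B D, Hom B D -> Hom A B -> Hom A D;
  comp_idl : forall A B (f : Hom A B), comp (idm B) f = f;
  comp_idr : forall A B (f : Hom A B), comp f (idm A) = f;
  comp_assoc : forall A B D E (h : Hom D E) (g : Hom B D) (f : Hom A B),
    comp h (comp g f) = comp (comp h g) f
}.

Arguments Hom {_} _ _.
Arguments idm {_} _.
Arguments comp {_ _ _ _} _ _.

Notation "g ∘ f" := (comp g f) (at level 40, left associativity) : cat_scope.

Record Functor (C D : Category) := {
  fob :> C -> D;
  fmap : forall A B : C, Hom A B -> Hom (fob A) (fob B);
  fmap_id : forall A : C, fmap (idm A) = idm (fob A);
  fmap_comp : forall (A B E : C) (g : Hom B E) (f : Hom A B),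
    fmap (g ∘ f) = fmap g ∘ fmap f
}.

Arguments fmap {C D} F {A B} f : rename.

Definition id_functor (C : Category) : Functor C C :=
  {| fob := fun A => A;
     fmap := fun A B f => f;
     fmap_id := fun A => eq_refl;
     fmap_comp := fun A B E g f => eq_refl |}.

Definition comp_functor (C D E : Category) (G : Functor D E) (F : Functor C D) :
  Functor C E.
Proof.
refine {| fob := fun A => G (F A); fmap := fun A B f => fmap G (fmap F f) |}.
- intros A. rewrite fmap_id. apply fmap_id.
- intros A B X g f. rewrite fmap_comp. apply fmap_comp.
Defined.

Record NatTrans (C D : Category) (F G : Functor C D) := {
  component :> forall A : C, Hom (F A) (G A);
  naturality : forall (A B : C) (f : Hom A B),
    component B ∘ fmap F f = fmap G f ∘ component A
}.

(** * Finite limits *)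

Definition FiniteCategory (J : Category) : Prop :=
  Finite J /\ forall i j : J, Finite (Hom i j).

Record Cone (J C : Category) (D : Functor J C) := {
  apex : C;
  leg : forall j : J, Hom apex (D j);
  leg_nat : forall (i j : J) (u : Hom i j), fmap D u ∘ leg i = leg j
}.

Arguments leg {J C D} c j : rename.

Definition IsLimit (J C : Category) (D : Functor J C) (c : Cone D) : Prop :=
  forall d : Cone D,
    exists! u : Hom (apex d) (apex c), forall j : J, leg c j ∘ u = leg d j.

Definition HasFiniteLimits (C : Category) : Prop :=
  forall (J : Category) (D : Functor J C), FiniteCategory J ->
    exists c : Cone D, IsLimit c.

Definition map_cone (J C E : Category) (D : Functor J C) (F : Functor C E)
  (c : Cone D) : Cone (comp_functor F D).
Proof.
refine (@Build_Cone J E (comp_functor F D) (F (apex c))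
          (fun j => fmap F (leg c j)) _).
intros i j u. simpl. rewrite <- fmap_comp, leg_nat. reflexivity.
Defined.

Definition PreservesFiniteLimits (C E : Category) (F : Functor C E) : Prop :=
  forall (J : Category) (D : Functor J C) (c : Cone D),
    FiniteCategory J -> IsLimit c -> IsLimit (map_cone F c).

(** * Monomorphisms, pullbacks, subobjects *)

Definition IsMono (C : Category) (A B : C) (m : Hom A B) : Prop :=
  forall (X : C) (u v : Hom X A), m ∘ u = m ∘ v -> u = v.

Definition IsIso (C : Category) (A B : C) (f : Hom A B) : Prop :=
  exists g : Hom B A, g ∘ f = idm A /\ f ∘ g = idm B.

(** The square
<<
      P --q--> Y
      |        |
      p        g
      v        v
      X --f--> Z
>>
    *)
Definition IsPullback (C : Category) (P X Y Z : C)
  (p : Hom P X) (q : Hom P Y) (f : Hom X Z) (g : Hom Y Z) : Prop :=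
  f ∘ p = g ∘ q /\
  forall (Q : C) (a : Hom Q X) (b : Hom Q Y), f ∘ a = g ∘ b ->
    exists! u : Hom Q P, p ∘ u = a /\ q ∘ u = b.

Definition IsGenericMono (C : Category) (T Om : C) (t : Hom T Om) : Prop :=
  IsMono t /\
  forall (S A : C) (m : Hom S A), IsMono m ->
    exists (chi : Hom A Om) (v : Hom S T), IsPullback m v chi t.

Definition HasGenericMono (C : Category) : Prop :=
  exists (T Om : C) (t : Hom T Om), IsGenericMono t.

(** Subobjects are kept as a preorder: two monomorphisms represent the same
    subobject when each is below the other. *)
Record Sub (C : Category) (A : C) := {
  sdom : C;
  sarr : Hom sdom A;
  sarr_mono : IsMono sarr
}.

Arguments sarr {C A} s : rename.

Definition FactorsThrough (C : Category) (A X : C) (f : Hom X A) (S : Sub A) :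
  Prop :=
  exists u : Hom X (sdom S), sarr S ∘ u = f.

Definition SubLe (C : Category) (A : C) (S T : Sub A) : Prop :=
  FactorsThrough (sarr S) T.

(** [InvImage f T P]: the subobject [P] of [A] is f^*T.  Pullbacks are not
    chosen, so f^* appears as a relation, functional up to isomorphism. *)
Definition InvImage (C : Category) (A B : C) (f : Hom A B)
  (T : Sub B) (P : Sub A) : Prop :=
  exists q : Hom (sdom P) (sdom T), IsPullback (sarr P) q f (sarr T).

(** * Regular, coherent and Heyting categories *)

Definition IsImage (C : Category) (A B : C) (f : Hom A B) (I : Sub B) : Prop :=
  FactorsThrough f I /\ forall S : Sub B, FactorsThrough f S -> SubLe I S.

Definition IsCover (C : Category) (A B : C) (f : Hom A B) : Prop :=
  forall S : Sub B, FactorsThrough f S -> IsIso (sarr S).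

Record IsRegular (C : Category) : Prop := {
  regular_limits : HasFiniteLimits C;
  regular_images : forall (A B : C) (f : Hom A B),
    exists I : Sub B, IsImage f I;
  regular_covers : forall (P X Y Z : C)
    (p : Hom P X) (q : Hom P Y) (f : Hom X Z) (g : Hom Y Z),
    IsPullback p q f g -> IsCover g -> IsCover p
}.

(** Unions of finite families; the empty list gives the least subobject. *)
Definition IsUnion (C : Category) (A : C) (l : list (Sub A)) (U : Sub A) :
  Prop :=
  (forall S, In S l -> SubLe S U) /\
  forall V : Sub A, (forall S, In S l -> SubLe S V) -> SubLe U V.

Record IsCoherent (C : Category) : Prop := {
  coherent_regular : IsRegular C;
  coherent_unions : forall (A : C) (l : list (Sub A)),
    exists U : Sub A, IsUnion l U;
  coherent_stable : forall (A B : C) (f : Hom A B)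
    (l : list (Sub B)) (U : Sub B) (l' : list (Sub A)) (U' : Sub A),
    Forall2 (InvImage f) l l' -> InvImage f U U' ->
    IsUnion l U -> IsUnion l' U'
}.

(** [all_f] is the adjoint ∀_f : the Galois connection
    f^*T <= S  <->  T <= ∀_f S. *)
Definition IsRightAdjointOfInvImage (C : Category) (A B : C) (f : Hom A B)
  (all_f : Sub A -> Sub B) : Prop :=
  forall (T : Sub B) (P S : Sub A), InvImage f T P ->
    (SubLe P S <-> SubLe T (all_f S)).

Record IsHeyting (C : Category) : Prop := {
  heyting_coherent : IsCoherent C;
  heyting_forall : forall (A B : C) (f : Hom A B),
    exists all_f : Sub A -> Sub B, IsRightAdjointOfInvImage f all_f
}.

(** * Comonads and their coalgebras *)

Record Comonad (C : Category) := {
  cfun :> Functor C C;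
  counit : NatTrans cfun (id_functor C);
  comult : NatTrans cfun (comp_functor cfun cfun);
  counit_l : forall A : C, counit (cfun A) ∘ comult A = idm (cfun A);
  counit_r : forall A : C, fmap cfun (counit A) ∘ comult A = idm (cfun A);
  coassoc : forall A : C,
    comult (cfun A) ∘ comult A = fmap cfun (comult A) ∘ comult A
}.

Arguments counit {C} W : rename.
Arguments comult {C} W : rename.

Definition IsCartesian (C : Category) (W : Comonad C) : Prop :=
  PreservesFiniteLimits W.

Record Coalgebra (C : Category) (W : Comonad C) := {
  carrier : C;
  costr : Hom carrier (W carrier);
  costr_counit : counit W carrier ∘ costr = idm carrier;
  costr_comult : comult W carrier ∘ costr = fmap W costr ∘ costr
}.

Arguments costr {C W} X : rename.

Record CoalgHom (C : Category) (W : Comonad C) (X Y : Coalgebra W) := {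
  cmap : Hom (carrier X) (carrier Y);
  cmap_costr : costr Y ∘ cmap = fmap W cmap ∘ costr X
}.

Arguments cmap {C W X Y} h : rename.

Lemma coalg_hom_eq (C : Category) (W : Comonad C) (X Y : Coalgebra W)
  (h k : CoalgHom X Y) : cmap h = cmap k -> h = k.
Proof.
destruct h as [h hP], k as [k kP]; simpl; intros e; subst k.
f_equal; apply proof_irrelevance.
Qed.

Definition coalg_id (C : Category) (W : Comonad C) (X : Coalgebra W) :
  CoalgHom X X.
Proof.
refine {| cmap := idm (carrier X) |}.
rewrite fmap_id, comp_idl, comp_idr. reflexivity.
Defined.

Definition coalg_comp (C : Category) (W : Comonad C) (X Y Z : Coalgebra W)
  (k : CoalgHom Y Z) (h : CoalgHom X Y) : CoalgHom X Z.
Proof.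
refine {| cmap := cmap k ∘ cmap h |}.
rewrite comp_assoc, cmap_costr, <- comp_assoc, cmap_costr, comp_assoc, fmap_comp.
reflexivity.
Defined.

Definition CoalgebraCategory (C : Category) (W : Comonad C) : Category.
Proof.
refine {| Ob := Coalgebra W;
          Hom := @CoalgHom C W;
          idm := @coalg_id C W;
          comp := @coalg_comp C W |}.
- intros. apply coalg_hom_eq, comp_idl.
- intros. apply coalg_hom_eq, comp_idr.
- intros. apply coalg_hom_eq, comp_assoc.
Defined.

(* Main.v *)
From Stdlib Require Import List IndefiniteDescription.
Require Import Defs.

(** Let [U] be the forgetful functor from coalgebras of [Box] to [C].  Because
    [Box] preserves finite limits, [U] creates them: a limit in [C] of
    underlying objects has exactly one compatible coalgebra structure
    ([forgetful_creates]).  Hence [U] preserves and reflects pullbacks and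
    monomorphisms, and the subobjects of a coalgebra [X] form a full sub-preorder
    of the subobjects of its carrier ([sub_le_under]).

    The decisive fact is that this sub-preorder is coreflective ([interior]):
    for a subobject [S] of the carrier, the pullback of [Box S] along the structure
    map of [X] underlies a subcoalgebra [int S], and a coalgebra morphism into [X]
    factors through [int S] as soon as its underlying arrow factors through
    [S].  It follows formally that images, unions and covers of coalgebras are those
    of [C], which gives coherence, and that [int (∀_f S)] is right adjoint to
    inverse image.

    Finally, if [t] is a generic monomorphism of [C], then [Box t], seen between
    cofree coalgebras, is generic.  A subcoalgebra [m] of [X] is the pullback of
    [Box m] along the structure map of [X] ([costr_square_pullback]).  If
    [χ] classifies [m] in [C], then [Box m] is the pullback of [Box t] along
    [Box χ].  Pasting shows that the transpose of [χ] classifies [m]. *)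

Set Implicit Arguments.
Unset Strict Implicit.
Unset Printing Implicit Defensive.
Local Open Scope cat_scope.

(** * Limits and pullbacks *)

Lemma limit_jointly_monic (J C : Category) (D : Functor J C) (c : Cone D)
  (X : C) (u v : Hom X (apex c)) :
  IsLimit c -> (forall j, leg c j ∘ u = leg c j ∘ v) -> u = v.
Proof.
intros lim e.
assert (nat : forall (i j : J) (h : Hom i j),
  fmap D h ∘ (leg c i ∘ v) = leg c j ∘ v).
{ intros i j h. rewrite comp_assoc, leg_nat. reflexivity. }
destruct (lim (Build_Cone nat)) as [w [_ uniq]]; simpl in uniq.
transitivity w; [symmetry|]; apply uniq; auto.
Qed.

Lemma limit_transfer (J C : Category) (D : Functor J C) (c c' : Cone D)
  (u : Hom (apex c') (apex c)) (v : Hom (apex c) (apex c')) :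
  IsLimit c' -> u ∘ v = idm _ ->
  (forall j, leg c j ∘ u = leg c' j) -> (forall j, leg c' j ∘ v = leg c j) ->
  IsLimit c.
Proof.
intros lim uv lu lv d.
destruct (lim d) as [w [wl wu]].
exists (u ∘ w); split.
- intros j. rewrite comp_assoc, lu. apply wl.
- intros x xl. rewrite (wu (v ∘ x)).
  + rewrite comp_assoc, uv. apply comp_idl.
  + intros j. rewrite comp_assoc, lv. apply xl.
Qed.

Lemma pullback_jointly_monic (C : Category) (P X Y Z : C)
  (p : Hom P X) (q : Hom P Y) (f : Hom X Z) (g : Hom Y Z)
  (Q : C) (u v : Hom Q P) :
  IsPullback p q f g -> p ∘ u = p ∘ v -> q ∘ u = q ∘ v -> u = v.
Proof.
intros [sq pb] ep eq.
destruct (pb Q (p ∘ v) (q ∘ v)) as [w [_ uniq]].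
{ rewrite !comp_assoc, sq. reflexivity. }
transitivity w; [symmetry|]; apply uniq; auto.
Qed.

Lemma pullback_mono (C : Category) (P X Y Z : C)
  (p : Hom P X) (q : Hom P Y) (f : Hom X Z) (g : Hom Y Z) :
  IsPullback p q f g -> IsMono g -> IsMono p.
Proof.
intros pb mg Q u v e.
apply (pullback_jointly_monic pb e).
apply mg. rewrite !comp_assoc, <- (proj1 pb), <- !comp_assoc, e. reflexivity.
Qed.

Lemma pullback_paste (C : Category) (P Y Y' X Z Z' : C)
  (p : Hom P X) (q : Hom P Y) (f : Hom X Z) (g : Hom Y Z)
  (q' : Hom Y Y') (f' : Hom Z Z') (g' : Hom Y' Z') :
  IsPullback p q f g -> IsPullback g q' f' g' ->
  IsPullback p (q' ∘ q) (f' ∘ f) g'.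
Proof.
intros pb1 pb2; split.
- rewrite <- comp_assoc, (proj1 pb1), comp_assoc, (proj1 pb2).
  symmetry; apply comp_assoc.
- intros Q a b e.
  destruct (proj2 pb2 Q (f ∘ a) b) as [y [[y1 y2] _]].
  { rewrite comp_assoc. exact e. }
  destruct (proj2 pb1 Q a y) as [u [[u1 u2] uu]].
  { symmetry; exact y1. }
  exists u; split.
  + split; [exact u1|]. rewrite <- comp_assoc, u2. exact y2.
  + intros w [w1 w2]. apply uu. split; [exact w1|].
    apply (pullback_jointly_monic pb2).
    * rewrite y1, comp_assoc, <- (proj1 pb1), <- comp_assoc, w1. reflexivity.
    * rewrite y2, comp_assoc. exact w2.
Qed.

(** Expresses monicity by a pullback square, which makes it preserved by every
    functor that preserves pullbacks. *)
Lemma mono_iff_pullback (C : Category) (A B : C) (m : Hom A B) :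
  IsMono m <-> IsPullback (idm A) (idm A) m m.
Proof.
split.
- intros mono; split; [reflexivity|].
  intros Q a b e. exists a. split.
  + rewrite !comp_idl. split; [reflexivity|]. exact (mono _ _ _ e).
  + intros w [w1 _]. rewrite comp_idl in w1. symmetry; exact w1.
- intros [_ pb] X u v e.
  destruct (pb X u v e) as [w [[w1 w2] _]].
  rewrite comp_idl in w1, w2. congruence.
Qed.

(** * Pullbacks as finite limits *)

Inductive cospan_ob : Type := Lft | Rgt | Mid.

(** Each hom-type is [unit] or empty: the category is a preorder, so all its
    equations hold by case analysis. *)
Definition cospan_hom (i j : cospan_ob) : Type :=
  match i, j with
  | Lft, Lft | Rgt, Rgt | _, Mid => unit
  | _, _ => Empty_set
  end.

Definition Cospan : Category.
Proof.
refine {| Ob := cospan_ob; Hom := cospan_hom;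
          idm := fun i => match i return cospan_hom i i with
                          | Lft => tt | Rgt => tt | Mid => tt
                          end;
          comp := fun i j k (g : cospan_hom j k) (f : cospan_hom i j) => _ |}.
Unshelve.
4: destruct i, j, k; simpl in *; solve [exact tt | destruct f | destruct g].
all: repeat intros []; simpl; intros; repeat match goal with
  | u : unit |- _ => destruct u | u : Empty_set |- _ => destruct u end;
  reflexivity.
Defined.

Lemma cospan_finite : FiniteCategory Cospan.
Proof.
split.
- exists (Lft :: Rgt :: Mid :: nil). intros []; simpl; auto.
- intros [] []; simpl; (exists nil; intros []; fail) ||
    (exists (tt :: nil); intros []; simpl; auto).
Qed.

Definition cospan_left : @Hom Cospan Lft Mid := tt.
Definition cospan_right : @Hom Cospan Rgt Mid := tt.

Definition cospan_diagram (C : Category) (X Y Z : C)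
  (f : Hom X Z) (g : Hom Y Z) : Functor Cospan C.
Proof.
set (ob := fun i : Cospan => match i with Lft => X | Rgt => Y | Mid => Z end).
refine {| fob := ob;
  fmap := fun i j : Cospan =>
    match i, j return cospan_hom i j -> Hom (ob i) (ob j) with
    | Lft, Lft => fun _ => idm X
    | Rgt, Rgt => fun _ => idm Y
    | Mid, Mid => fun _ => idm Z
    | Lft, Mid => fun _ => f
    | Rgt, Mid => fun _ => g
    | _, _ => fun u : Empty_set => match u with end
    end |}.
- intros []; reflexivity.
- intros [] [] [] u v; simpl in *;
    solve [destruct u | destruct v | symmetry; apply comp_idl
          | symmetry; apply comp_idr].
Defined.

Definition square_cone (C : Category) (D : Functor Cospan C) (P : C)
  (p : Hom P (D Lft)) (q : Hom P (D Rgt))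
  (sq : fmap D cospan_left ∘ p = fmap D cospan_right ∘ q) : Cone D.
Proof.
refine {| apex := P;
  leg := fun j : Cospan => match j return Hom P (D j) with
    | Lft => p | Rgt => q | Mid => fmap D cospan_left ∘ p end |}.
intros [] [] u; simpl in u; destruct u.
- change (fmap D (idm (Lft : Cospan)) ∘ p = p).
  rewrite fmap_id. apply comp_idl.
- reflexivity.
- change (fmap D (idm (Rgt : Cospan)) ∘ q = q).
  rewrite fmap_id. apply comp_idl.
- symmetry; exact sq.
- change (fmap D (idm (Mid : Cospan)) ∘ (fmap D cospan_left ∘ p)
          = fmap D cospan_left ∘ p).
  rewrite fmap_id. apply comp_idl.
Defined.

(** Stated for an arbitrary diagram rather than for [cospan_diagram f g], so
    that it applies as it stands to the composite of a cospan with a functor. *)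
Lemma limit_iff_pullback (C : Category) (D : Functor Cospan C) (c : Cone D) :
  IsLimit c <->
  IsPullback (leg c Lft) (leg c Rgt) (fmap D cospan_left) (fmap D cospan_right).
Proof.
split.
- intros lim; split.
  { rewrite !leg_nat. reflexivity. }
  intros Q a b e.
  destruct (lim (square_cone e)) as [u [ul uu]]; simpl in *.
  exists u; split.
  + split; [exact (ul Lft) | exact (ul Rgt)].
  + intros w [w1 w2]. apply uu. intros []; [exact w1 | exact w2 |].
    rewrite <- (leg_nat c cospan_left), <- comp_assoc, w1. reflexivity.
- intros pb d.
  destruct (proj2 pb (apex d) (leg d Lft) (leg d Rgt)) as [u [[u1 u2] uu]].
  { rewrite !leg_nat. reflexivity. }
  exists u; split.
  + intros []; [exact u1 | exact u2 |].
    rewrite <- (leg_nat c cospan_left), <- (leg_nat d cospan_left),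
      <- comp_assoc, u1. reflexivity.
  + intros w wl. apply uu; split; apply wl.
Qed.

Lemma has_pullbacks (C : Category) : HasFiniteLimits C ->
  forall (X Y Z : C) (f : Hom X Z) (g : Hom Y Z),
    exists (P : C) (p : Hom P X) (q : Hom P Y), IsPullback p q f g.
Proof.
intros lim X Y Z f g.
destruct (lim Cospan (cospan_diagram f g) cospan_finite) as [c cl].
apply limit_iff_pullback in cl.
exists (apex c), (leg c Lft), (leg c Rgt). exact cl.
Qed.

Lemma preserves_pullbacks (C E : Category) (F : Functor C E) :
  PreservesFiniteLimits F ->
  forall (P X Y Z : C) (p : Hom P X) (q : Hom P Y) (f : Hom X Z) (g : Hom Y Z),
    IsPullback p q f g -> IsPullback (fmap F p) (fmap F q) (fmap F f) (fmap F g).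
Proof.
intros pres P X Y Z p q f g pb.
pose (c := @square_cone C (cospan_diagram f g) P p q (proj1 pb)).
assert (cl : IsLimit c) by (apply limit_iff_pullback; exact pb).
apply (pres _ _ _ cospan_finite) in cl.
apply limit_iff_pullback in cl. exact cl.
Qed.

Lemma preserves_mono (C E : Category) (F : Functor C E) :
  PreservesFiniteLimits F ->
  forall (A B : C) (m : Hom A B), IsMono m -> IsMono (fmap F m).
Proof.
intros pres A B m mono.
apply mono_iff_pullback in mono. apply mono_iff_pullback.
apply (preserves_pullbacks pres) in mono. rewrite fmap_id in mono. exact mono.
Qed.

(** * The preorder of subobjects *)

Lemma factors_le (C : Category) (A X : C) (f : Hom X A) (S T : Sub A) :
  FactorsThrough f S -> SubLe S T -> FactorsThrough f T.
Proof.
intros [u eu] [v ev]. exists (v ∘ u).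
rewrite comp_assoc, ev. exact eu.
Qed.

Lemma sub_iso_iff (C : Category) (A : C) (S : Sub A) :
  IsIso (sarr S) <-> FactorsThrough (idm A) S.
Proof.
split.
- intros [g [_ e]]. exists g. exact e.
- intros [g e]. exists g. split; [|exact e].
  apply (sarr_mono (s := S)).
  rewrite comp_assoc, e, comp_idl, comp_idr. reflexivity.
Qed.

(** * Limits of coalgebras *)

Definition forgetful (C : Category) (W : Comonad C) :
  Functor (CoalgebraCategory W) C :=
  {| fob := fun X : CoalgebraCategory W => carrier X;
     fmap := fun (X Y : CoalgebraCategory W) (f : Hom X Y) => cmap f;
     fmap_id := fun X => eq_refl;
     fmap_comp := fun X Y Z g f => eq_refl |}.

Lemma forgetful_reflects_mono (C : Category) (W : Comonad C)
  (X Y : CoalgebraCategory W) (m : Hom X Y) : IsMono (cmap m) -> IsMono m.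
Proof.
intros mono Z u v e. apply coalg_hom_eq, mono.
exact (f_equal (@cmap _ _ _ _) e).
Qed.

Lemma counit_natural (C : Category) (W : Comonad C) (A B : C) (f : Hom A B) :
  counit W B ∘ fmap W f = f ∘ counit W A.
Proof. exact (naturality (counit W) f). Qed.

Lemma comult_natural (C : Category) (W : Comonad C) (A B : C) (f : Hom A B) :
  comult W B ∘ fmap W f = fmap W (fmap W f) ∘ comult W A.
Proof. exact (naturality (comult W) f). Qed.

Section Coalgebras.

Context (C : Category) (W : Comonad C).
Context (lim : HasFiniteLimits C) (cart : IsCartesian W).

Lemma forgetful_reflects_limits (J : Category)
  (D : Functor J (CoalgebraCategory W)) (c : Cone D) :
  FiniteCategory J -> IsLimit (map_cone (forgetful W) c) -> IsLimit c.
Proof.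
intros fin cl d.
destruct (cl (map_cone (forgetful W) d)) as [u [ul uu]]; simpl in *.
assert (hu : costr (apex c) ∘ u = fmap W u ∘ costr (apex d)).
{ apply (limit_jointly_monic (cart fin cl)); intros j; simpl.
  rewrite !comp_assoc, <- fmap_comp, ul, <- !cmap_costr, <- comp_assoc, ul.
  reflexivity. }
exists (@Build_CoalgHom C W (apex d) (apex c) u hu); split.
- intros j. apply coalg_hom_eq. simpl. apply ul.
- intros w wl. apply coalg_hom_eq, uu.
  intros j. exact (f_equal (@cmap _ _ _ _) (wl j)).
Qed.

(** The structure map on the limit in [C] is induced by those of the diagram,
    since [W] preserves that limit; the counit law is checked against the
    limit itself, coassociativity against its image under [W] applied
    twice. *)
Lemma forgetful_creates (J : Category)
  (D : Functor J (CoalgebraCategory W)) : FiniteCategory J ->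
  exists c : Cone D, IsLimit (map_cone (forgetful W) c).
Proof.
intros fin.
destruct (lim (comp_functor (forgetful W) D) fin) as [c cl].
pose proof (cart fin cl) as Wcl.
pose proof (cart fin Wcl) as WWcl.
assert (nat : forall (i j : J) (u : Hom i j),
  fmap (comp_functor W (comp_functor (forgetful W) D)) u ∘
    (costr (D i) ∘ leg c i) = costr (D j) ∘ leg c j).
{ intros i j u. simpl. rewrite comp_assoc, <- cmap_costr, <- comp_assoc.
  f_equal. exact (leg_nat c u). }
destruct (Wcl (Build_Cone nat)) as [h [h_leg _]]; simpl in h, h_leg.
pose (l := fun j => leg c j : Hom (apex c) (carrier (D j))).
assert (hl : forall j, fmap W (l j) ∘ h = costr (D j) ∘ l j) by exact h_leg.
assert (h_counit : counit W (apex c) ∘ h = idm (apex c)).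
{ apply (limit_jointly_monic cl). intros j.
  change (l j ∘ (counit W (apex c) ∘ h) = l j ∘ idm _).
  rewrite comp_assoc, <- counit_natural, <- comp_assoc, hl, comp_assoc,
    costr_counit, comp_idl, comp_idr. reflexivity. }
assert (h_comult : comult W (apex c) ∘ h = fmap W h ∘ h).
{ apply (limit_jointly_monic WWcl). intros j.
  change (fmap W (fmap W (l j)) ∘ (comult W (apex c) ∘ h)
          = fmap W (fmap W (l j)) ∘ (fmap W h ∘ h)).
  rewrite comp_assoc, <- comult_natural, <- comp_assoc, hl, comp_assoc,
    costr_comult.
  rewrite (comp_assoc (fmap W (fmap W (l j)))), <- fmap_comp, hl, fmap_comp,
    <- !comp_assoc, hl. reflexivity. }
pose (A := {| carrier := apex c; costr := h;
              costr_counit := h_counit; costr_comult := h_comult |}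
           : CoalgebraCategory W).
pose (k := fun j => @Build_CoalgHom C W A (D j) (l j) (eq_sym (hl j))
                    : Hom A (D j)).
assert (k_nat : forall (i j : J) (u : Hom i j), fmap D u ∘ k i = k j).
{ intros i j u. apply coalg_hom_eq. exact (leg_nat c u). }
exists (Build_Cone k_nat).
intros d. exact (cl d).
Qed.

Lemma coalgebra_limits : HasFiniteLimits (CoalgebraCategory W).
Proof.
intros J D fin. destruct (forgetful_creates D fin) as [c cl].
exists c. exact (forgetful_reflects_limits fin cl).
Qed.

(** Any limit cone of coalgebras is isomorphic to the created one, whose
    underlying cone is a limit. *)
Lemma forgetful_preserves_limits : PreservesFiniteLimits (forgetful W).
Proof.
intros J D c fin cl.
destruct (forgetful_creates D fin) as [c' cl'].
pose proof (forgetful_reflects_limits fin cl') as cl''.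
destruct (cl c') as [u [ul _]]. destruct (cl'' c) as [v [vl _]].
refine (@limit_transfer _ _ _ (map_cone (forgetful W) c) (map_cone _ c')
  (cmap u) (cmap v) cl' _ _ _).
- refine (f_equal (@cmap _ _ _ _) (_ : u ∘ v = idm _)).
  apply (limit_jointly_monic cl). intros j.
  rewrite comp_assoc, ul, vl, comp_idr. reflexivity.
- intros j. exact (f_equal (@cmap _ _ _ _) (ul j)).
- intros j. exact (f_equal (@cmap _ _ _ _) (vl j)).
Qed.

Lemma forgetful_reflects_pullbacks (P X Y Z : CoalgebraCategory W)
  (p : Hom P X) (q : Hom P Y) (f : Hom X Z) (g : Hom Y Z) :
  IsPullback (cmap p) (cmap q) (cmap f) (cmap g) -> IsPullback p q f g.
Proof.
intros pb.
assert (sq : f ∘ p = g ∘ q) by (apply coalg_hom_eq; exact (proj1 pb)).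
pose (c := @square_cone _ (cospan_diagram f g) P p q sq).
apply (limit_iff_pullback c), forgetful_reflects_limits.
- exact cospan_finite.
- apply limit_iff_pullback. exact pb.
Qed.

(** * Subcoalgebras *)

Definition under (X : CoalgebraCategory W) (S : Sub X) : Sub (carrier X) :=
  {| sarr := cmap (sarr S);
     sarr_mono := preserves_mono forgetful_preserves_limits
                    (sarr_mono (s := S)) |}.

(** [W] of the subobject is again monic, so a factorization of a coalgebra
    morphism through a subcoalgebra is automatically a coalgebra morphism. *)
Lemma factors_under (X Y : CoalgebraCategory W) (f : Hom Y X) (S : Sub X) :
  FactorsThrough (cmap f) (under S) <-> FactorsThrough f S.
Proof.
split.
- intros [u eu]; simpl in u, eu.
  assert (hu : costr (sdom S) ∘ u = fmap W u ∘ costr Y).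
  { apply (preserves_mono cart (sarr_mono (s := under S))); simpl.
    rewrite !comp_assoc, <- fmap_comp, eu, <- !cmap_costr, <- comp_assoc, eu.
    reflexivity. }
  exists (@Build_CoalgHom C W Y (sdom S) u hu). apply coalg_hom_eq. exact eu.
- intros [u eu]. exists (cmap u). exact (f_equal (@cmap _ _ _ _) eu).
Qed.

Lemma sub_le_under (X : CoalgebraCategory W) (S T : Sub X) :
  SubLe (under S) (under T) <-> SubLe S T.
Proof. apply (factors_under (sarr S)). Qed.

Lemma inv_image_under (X Y : CoalgebraCategory W) (f : Hom X Y)
  (T : Sub Y) (P : Sub X) :
  InvImage f T P -> InvImage (cmap f) (under T) (under P).
Proof.
intros [q pb]. exists (cmap q).
exact (preserves_pullbacks forgetful_preserves_limits pb).
Qed.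

(** The largest subcoalgebra contained in [S] is the pullback of [W S] along
    the structure map.  Its coalgebra structure comes from the fact that
    [W] preserves this pullback, together with the comultiplication of
    [W S]. *)
Lemma interior (X : CoalgebraCategory W) (S : Sub (carrier X)) :
  exists T : Sub X, SubLe (under T) S /\
    forall (Y : CoalgebraCategory W) (f : Hom Y X),
      FactorsThrough (cmap f) S -> FactorsThrough f T.
Proof.
destruct S as [S s mono].
destruct (has_pullbacks lim (costr X) (fmap W s)) as [P [p [q pb]]].
pose proof (pullback_mono pb (preserves_mono cart mono)) as p_mono.
pose proof (preserves_mono cart p_mono) as Wp_mono.
pose proof (preserves_mono cart Wp_mono) as WWp_mono.
destruct (proj2 (preserves_pullbacks cart pb) P (costr X ∘ p) (comult W S ∘ q))
  as [h [[h1 _] _]].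
{ rewrite !comp_assoc, <- costr_comult, <- comult_natural, <- !comp_assoc,
    (proj1 pb). reflexivity. }
assert (h_counit : counit W P ∘ h = idm P).
{ apply p_mono. rewrite comp_assoc, <- counit_natural, <- comp_assoc, h1,
    comp_assoc, costr_counit, comp_idl, comp_idr. reflexivity. }
assert (h_comult : comult W P ∘ h = fmap W h ∘ h).
{ apply WWp_mono. rewrite comp_assoc, <- comult_natural, <- comp_assoc, h1,
    comp_assoc, costr_comult.
  rewrite comp_assoc, <- fmap_comp, h1, fmap_comp, <- !comp_assoc, h1.
  reflexivity. }
pose (A := {| carrier := P; costr := h;
              costr_counit := h_counit; costr_comult := h_comult |}
           : CoalgebraCategory W).
pose (i := @Build_CoalgHom C W A X p (eq_sym h1) : Hom A X).
exists (@Build_Sub _ X A i (@forgetful_reflects_mono _ _ A X i p_mono)); split.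
- (* The counit carries the pulled back copy of [W S] into [S]. *)
  exists (counit W S ∘ q); simpl.
  rewrite comp_assoc, <- counit_natural, <- comp_assoc, <- (proj1 pb),
    comp_assoc, costr_counit. apply comp_idl.
- intros Y f [u eu]; simpl in u, eu.
  apply factors_under.
  destruct (proj2 pb (carrier Y) (cmap f) (fmap W u ∘ costr Y))
    as [w [[w1 _] _]].
  { rewrite cmap_costr, comp_assoc, <- fmap_comp, eu. reflexivity. }
  exists w. exact w1.
Qed.

(** * Regular structure *)

(** If [f] factors through [S] in [C], it factors through the interior of [S];
    so the interior of the image of [f] in [C] is the whole of that image. *)
Lemma coalgebra_images : IsRegular C ->
  forall (X Y : CoalgebraCategory W) (f : Hom X Y),
    exists I : Sub Y, IsImage f I.
Proof.
intros reg X Y f.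
destruct (regular_images reg (cmap f)) as [I [fac least]].
destruct (interior I) as [T [TI univ]].
exists T. split.
- apply univ. exact fac.
- intros S fS. apply sub_le_under.
  apply (factors_le TI). apply least, factors_under. exact fS.
Qed.

(** The underlying arrow of [f] is tested against subobjects that need not be
    subcoalgebras; each may be replaced by its interior, through which [f]
    still factors. *)
Lemma cover_under (X Y : CoalgebraCategory W) (f : Hom X Y) :
  IsCover f <-> IsCover (cmap f).
Proof.
split; intros cov S fS; apply sub_iso_iff.
- destruct (interior S) as [T [TS univ]].
  refine (factors_le (S := under T) _ TS).
  apply (factors_under (idm Y)), sub_iso_iff, cov, univ. exact fS.
- apply factors_under, (sub_iso_iff (under S)), cov, factors_under. exact fS.
Qed.

Lemma coalgebra_regular : IsRegular C -> IsRegular (CoalgebraCategory W).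
Proof.
intros reg; split.
- exact coalgebra_limits.
- exact (coalgebra_images reg).
- intros P X Y Z p q f g pb cov.
  apply cover_under in cov. apply cover_under.
  apply (regular_covers reg
    (preserves_pullbacks forgetful_preserves_limits pb)).
  exact cov.
Qed.

(** * Unions and universal quantification *)

(** An upper bound in [C] of a family of subcoalgebras may be shrunk to its
    interior, which is still an upper bound; so the least upper bound among
    subcoalgebras is also the least among all subobjects. *)
Lemma union_under (X : CoalgebraCategory W) (l : list (Sub X)) (U : Sub X) :
  IsUnion l U <-> IsUnion (map (@under X) l) (under U).
Proof.
split; intros [ub least]; split.
- intros S' inS. apply in_map_iff in inS. destruct inS as [S [<- inS]].
  apply sub_le_under, ub. exact inS.
- intros V bound. destruct (interior V) as [T [TV univ]].
  refine (factors_le (S := under T) _ TV).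
  apply (sub_le_under U T), least. intros S inS.
  apply univ, (bound (under S)), in_map. exact inS.
- intros S inS. apply sub_le_under, (ub (under S)), in_map. exact inS.
- intros V bound. apply sub_le_under, least. intros S' inS.
  apply in_map_iff in inS. destruct inS as [S [<- inS]].
  apply sub_le_under, bound. exact inS.
Qed.

Lemma coalgebra_coherent : IsCoherent C -> IsCoherent (CoalgebraCategory W).
Proof.
intros coh; split.
- exact (coalgebra_regular (coherent_regular coh)).
- intros X l.
  destruct (coherent_unions coh (map (@under X) l)) as [U [ub least]].
  destruct (interior U) as [T [TU univ]].
  exists T. split.
  + intros S inS. apply univ, (ub (under S)), in_map. exact inS.
  + intros V bound. apply sub_le_under, (factors_le TU), least.
    intros S' inS. apply in_map_iff in inS. destruct inS as [S [<- inS]].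
    apply sub_le_under, bound. exact inS.
- intros X Y f l U l' U' inv invU un.
  apply union_under in un. apply union_under.
  refine (coherent_stable coh (f := cmap f) _ (inv_image_under invU) un).
  clear -inv. induction inv; simpl; constructor; auto using inv_image_under.
Qed.

(** For a subcoalgebra [T], being below [∀_f S] and being below its interior
    are the same, so the interior of [∀_f S] is the right adjoint. *)
Lemma coalgebra_heyting : IsHeyting C -> IsHeyting (CoalgebraCategory W).
Proof.
intros hey; split.
{ exact (coalgebra_coherent (heyting_coherent hey)). }
intros X Y f.
destruct (heyting_forall hey (cmap f)) as [all_f adj].
destruct (functional_choice
  (fun (S : Sub X) (R : Sub Y) => forall (T : Sub Y) (P : Sub X),
     InvImage f T P -> (SubLe P S <-> SubLe T R))) as [F HF].
- intros S. destruct (interior (X := Y) (all_f (under S))) as [R [RS univ]].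
  exists R. intros T P inv.
  rewrite <- sub_le_under, (adj _ _ _ (inv_image_under inv)). split.
  + apply univ.
  + intros le. apply sub_le_under in le. exact (factors_le le RS).
- exists F. intros T P S inv. apply HF. exact inv.
Qed.

(** * Cofree coalgebras and the generic monomorphism *)

Definition cofree (A : C) : CoalgebraCategory W :=
  {| carrier := W A; costr := comult W A;
     costr_counit := counit_l W A; costr_comult := coassoc W A |}.

Definition cofree_map (A B : C) (f : Hom A B) : Hom (cofree A) (cofree B) :=
  @Build_CoalgHom C W (cofree A) (cofree B) (fmap W f)
    (comult_natural W f).

Lemma transpose_costr (X : CoalgebraCategory W) (A : C)
  (f : Hom (carrier X) A) :
  comult W A ∘ (fmap W f ∘ costr X)
  = fmap W (fmap W f ∘ costr X) ∘ costr X.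
Proof.
rewrite comp_assoc, comult_natural, <- comp_assoc, costr_comult, fmap_comp,
  !comp_assoc. reflexivity.
Qed.

Definition transpose (X : CoalgebraCategory W) (A : C)
  (f : Hom (carrier X) A) : Hom X (cofree A) :=
  @Build_CoalgHom C W X (cofree A) (fmap W f ∘ costr X) (transpose_costr f).

(** A subcoalgebra equals its own interior: if an element of [X] is sent into
    [W S] by the structure map, then applying the counit, which returns the
    element, lands in [S]. *)
Lemma costr_square_pullback (S X : CoalgebraCategory W) (m : Hom S X) :
  IsMono (cmap m) ->
  IsPullback (cmap m) (costr S) (costr X) (fmap W (cmap m)).
Proof.
intros mono; split; [apply cmap_costr|].
intros Q a b e.
assert (eu : cmap m ∘ (counit W (carrier S) ∘ b) = a).
{ rewrite comp_assoc, <- counit_natural, <- comp_assoc, <- e, comp_assoc,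
    costr_counit. apply comp_idl. }
exists (counit W (carrier S) ∘ b); split.
- split; [exact eu|].
  apply (preserves_mono cart mono).
  rewrite comp_assoc, <- cmap_costr, <- comp_assoc, eu. exact e.
- intros w [w1 _]. apply mono. rewrite eu. symmetry; exact w1.
Qed.

(** The classifying square of [m] is pasted from the square of
    [costr_square_pullback] and the image under the comonad of the square
    that classifies the underlying monomorphism. *)
Lemma cofree_generic_mono (T Om : C) (t : Hom T Om) :
  IsGenericMono t -> IsGenericMono (cofree_map t).
Proof.
intros [mono gen]; split.
{ apply forgetful_reflects_mono. exact (preserves_mono cart mono). }
intros S X m m_mono.
pose proof (preserves_mono forgetful_preserves_limits m_mono) as um_mono.
destruct (gen _ _ _ um_mono) as [chi [v pb]].
exists (transpose chi), (transpose v).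
apply forgetful_reflects_pullbacks.
exact (pullback_paste (costr_square_pullback um_mono)
         (preserves_pullbacks cart pb)).
Qed.

End Coalgebras.

Theorem theoremA2 (C : Category) (Box : Comonad C) :
  IsHeyting C -> HasGenericMono C -> IsCartesian Box ->
  IsHeyting (CoalgebraCategory Box) /\ HasGenericMono (CoalgebraCategory Box).
Proof.
intros hey [T [Om [t gen]]] cart.
pose proof (regular_limits (coherent_regular (heyting_coherent hey))) as lim.
split.
- exact (coalgebra_heyting lim cart hey).
- exists (cofree Box T), (cofree Box Om), (cofree_map Box t).
  exact (cofree_generic_mono lim cart gen).
Qed.
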